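(* Let $I\subseteq\mathbb{R}$ be a nonempty open interval and let $f:I\to\mathbb{R}$ be a function. (i) Let $n\in\mathbb{N}$, let $P=(p_{i,j})\in\mathbb{R}^{n\times n}$ be a doubly stochastic matrix, and assume that there exist disjoint nonempty subsets $A,B\subseteq\{1,\dots,n\}$ such that the vector $$\frac{1}{|A|}\sum_{\alpha\in A}\boldsymbol{e}_\alpha-\frac{1}{|B|}\sum_{\beta\in B}\boldsymbol{e}_\beta$$ belongs to the linear span of the column vectors of $P$. If the inequality $$f\left(\frac{x_1+\cdots+x_n}{n}\right)\leq\frac{1}{n}\sum_{i=1}^{n}f(p_{i,1}x_1+\cdots+p_{i,n}x_n)$$ holds for all $x_1,\dots,x_n\in I$, then $f$ is Jensen convex on $I$. (ii) If $f$ is Jensen convex on $I$, then the inequality $$f\left(\frac{x_1+\cdots+x_n}{n}\right)\leq\frac{1}{n}\sum_{i=1}^{n}f(p_{i,1}x_1+\cdots+p_{i,n}x_n)$$ holds for all $n\in\mathbb{N}$, for all doubly stochastic matrices $P=(p_{i,j})\in\mathbb{R}^{n\times n}$ and for all $x_1,\dots,x_n\in I$.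
   Context: $\mathbb{N}$ denotes the set of positive integers. $\{\boldsymbol{e}_1,\dots,\boldsymbol{e}_n\}$ is the natural (standard) basis of $\mathbb{R}^n$, and $|A|$ is the cardinality of a finite set $A$. A matrix $P\in\mathbb{R}^{n\times n}$ is doubly stochastic if its entries are nonnegative and all its row sums and column sums equal $1$. A function $f:I\to\mathbb{R}$ is Jensen convex on $I$ if $f\left(\frac{x+y}{2}\right)\leq\frac{f(x)+f(y)}{2}$ for all $x,y\in I$. *)

(* Defs.v *)
From mathcomp Require Import all_boot all_order all_algebra.
From mathcomp Require Import boolp classical_sets reals topology normedtype.

Set Implicit Arguments.
Unset Strict Implicit.
Unset Printing Implicit Defensive.

Import Order.TTheory GRing.Theory Num.Theory.

Local Open Scope ring_scope.

Definition doubly_stochastic (R : realType) (n : nat) (P : 'M[R]_n) : Prop :=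
  [/\ forall i j, 0 <= P i j,
      forall i, \sum_j P i j = 1
    & forall j, \sum_i P i j = 1].

(* A function on the interval I is a total function R -> R, of which only the
   values on I matter. *)
Definition jensen_convex (R : realType) (I : set R) (f : R -> R) : Prop :=
  forall x y : R, I x -> I y -> f ((x + y) / 2) <= (f x + f y) / 2.

Definition uniform_cV (R : realType) (n : nat) (A : {set 'I_n}) : 'cV[R]_n :=
  #|A|%:R^-1 *: \sum_(a in A) delta_mx a 0.

Definition column_span (R : realType) (n : nat) (P : 'M[R]_n) :
    {vspace 'cV[R]_n} :=
  <<[seq col j P | j <- enum 'I_n]>>%VS.

(* Main.v *)
Require Import Defs.
From mathcomp Require Import all_boot all_order all_algebra.
From mathcomp Require Import boolp classical_sets reals topology normedtype.
From mathcomp Require Import ring lra.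
Import Order.TTheory GRing.Theory Num.Theory.
Import numFieldNormedType.Exports.

Local Open Scope ring_scope.

(** (ii) A doubly stochastic matrix does not change the mean of a vector and
    keeps its entries in the interval, so the claim is the discrete Jensen
    inequality for the vector [P x].  For [2 ^ k] points that inequality follows
    by iterating the midpoint inequality; any number [n] of points is padded up
    to a power of two with copies of their own mean [m], and the surplus terms
    [f m] then cancel ([jensen_mean]).

    (i) Write the given vector as [u = P t].  Applying the hypothesis to
    [x = c + s t] gives [P x = c + s u], whose mean is [c]; since the entries of
    [u] are [1/|A|] on [A], [-1/|B|] on [B] and [0] elsewhere, the terms outside
    [A] and [B] cancel and there remains
    [(|A| + |B|) f c <= |A| f (c + s/|A|) + |B| f (c - s/|B|)].
    This is a convexity inequality with the fixed weight [|A| / (|A| + |B|)],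
    but [s] must be small enough for all the [x_j] to lie in [I], so it is only
    known for nearby points; on a compact subinterval the allowed distance is
    uniform ([convex_upto_of_mean_ineq]).  The weight is changed to [1/2] by the
    identity of Daroczy and Pales ([convex_upto_half]), and the distance is
    removed by doubling it repeatedly ([convex_upto_double]). *)

(** * The discrete Jensen inequality *)

Lemma weighted_mean_in_interval {R : realType} {I : set R} {n : nat}
    {w x : 'I_n -> R} :
  is_interval I -> (forall i, 0 <= w i) -> \sum_i w i = 1 ->
  (forall i, I (x i)) -> I (\sum_i w i * x i).
Proof.
case: n w x => [|n] w x I_itv w_ge0 w_sum1 Ix.
  by move: w_sum1 => /eqP; rewrite big_ord0 eq_sym oner_eq0.
have [imin _ x_min] := arg_minP x (isT : xpredT (ord0 : 'I_n.+1)).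
have [imax _ x_max] := arg_maxP x (isT : xpredT (ord0 : 'I_n.+1)).
apply: (I_itv (x imin) (x imax)) => //.
rewrite -[x imin]mul1r -[x imax]mul1r -w_sum1 !mulr_suml.
by apply/andP; split; apply: ler_sum => i _; rewrite ler_wpM2l //;
  [apply: x_min | apply: x_max].
Qed.

Lemma mean_in_interval {R : realType} {I : set R} {n : nat} {x : 'I_n -> R} :
  is_interval I -> (0 < n)%N -> (forall i, I (x i)) -> I ((\sum_i x i) / n%:R).
Proof.
move=> I_itv n_gt0 Ix.
have n_neq0 : n%:R != 0 :> R by rewrite pnatr_eq0 -lt0n.
rewrite mulrC mulr_sumr.
apply: (weighted_mean_in_interval (w := fun=> n%:R^-1)) => // [i|].
  by rewrite invr_ge0.
by rewrite sumr_const card_ord -[LHS]mulr_natr mulVf.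
Qed.

(** The mean of [2 ^ k.+1] points is the midpoint of the means of its two
    halves. *)
Lemma jensen_mean_pow2 {R : realType} {I : set R} {f : R -> R} (k : nat)
    (y : nat -> R) :
  is_interval I -> jensen_convex I f -> (forall i, I (y i)) ->
  f ((\sum_(i < 2 ^ k) y i) / (2 ^ k)%:R)
    <= (\sum_(i < 2 ^ k) f (y i)) / (2 ^ k)%:R.
Proof.
move=> I_itv f_jensen; elim: k y => [|k IHk] y Iy.
  by rewrite expn0 !big_ord1 !divr1.
have q_gt0 : 0 < (2 ^ k)%:R :> R by rewrite ltr0n expn_gt0.
have halves (g : nat -> R) : (\sum_(i < 2 ^ k.+1) g i) / (2 ^ k.+1)%:R =
    ((\sum_(i < 2 ^ k) g i) / (2 ^ k)%:R
      + (\sum_(i < 2 ^ k) g (2 ^ k + i)%N) / (2 ^ k)%:R) / 2.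
  have -> : (2 ^ k.+1 = 2 ^ k + 2 ^ k)%N by rewrite expnS mul2n addnn.
  by rewrite big_split_ord natrD /=; field; rewrite !gt_eqF ?addr_gt0.
rewrite (halves y) (halves (f \o y)) /=.
apply: le_trans (f_jensen _ _ _ _) _; try by
  apply: mean_in_interval => //; rewrite expn_gt0.
rewrite ler_pM2r ?invr_gt0 ?ltr0n // lerD //; first exact: IHk.
exact: (IHk (fun i => y (2 ^ k + i)%N)).
Qed.

Lemma jensen_mean {R : realType} {I : set R} {f : R -> R} {n : nat}
    (y : 'I_n -> R) :
  is_interval I -> jensen_convex I f -> (0 < n)%N -> (forall i, I (y i)) ->
  f ((\sum_i y i) / n%:R) <= n%:R^-1 * \sum_i f (y i).
Proof.
move=> I_itv f_jensen n_gt0 Iy.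
have n_gt0R : 0 < n%:R :> R by rewrite ltr0n.
set m := _ / _; have Im : I m by exact: mean_in_interval.
pose z (i : nat) := oapp y m (insub i).
have Iz i : I (z i) by rewrite /z; case: insubP => [j _ _|_] //=; apply: Iy.
have padded_sum (g : R -> R) : \sum_(i < 2 ^ n) g (z i) =
    \sum_i g (y i) + ((2 ^ n)%:R - n%:R) * g m.
  have le_n : (n <= 2 ^ n)%N by rewrite ltnW // ltn_expl.
  rewrite -natrB //; move: (subnKC le_n) => /esym; move: (_ - n)%N => p ->.
  rewrite big_split_ord /=; congr (_ + _).
    by apply: eq_bigr => i _; rewrite /z valK.
  rewrite (eq_bigr (fun=> g m)) => [|i _].
    by rewrite sumr_const card_ord mulr_natl.
  by rewrite /z insubF //= ltnNge leq_addr.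
have := jensen_mean_pow2 n z I_itv f_jensen Iz.
rewrite (padded_sum id) (padded_sum f).
have q_gt0 : 0 < (2 ^ n)%:R :> R by rewrite ltr0n expn_gt0.
have -> : \sum_i y i = n%:R * m by rewrite /m mulrC divfK ?gt_eqF.
have -> : (n%:R * m + ((2 ^ n)%:R - n%:R) * m) / (2 ^ n)%:R = m.
  by field; rewrite gt_eqF.
rewrite ler_pdivlMr // => le_q.
rewrite mulrC ler_pdivlMr //; lra.
Qed.

(** * Convexity inequalities for nearby points *)

(** The weight [t] is fixed, and [d] bounds the distance of the two points; the
    value [t = 2^-1] gives the midpoint inequality. *)
Definition convex_upto {R : realType} (f : R -> R) (l r t d : R) : Prop :=
  forall u v, l <= u <= r -> l <= v <= r -> `|u - v| <= d ->
    f (t * u + (1 - t) * v) <= t * f u + (1 - t) * f v.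

(** The midpoint [m] of [u] and [v] is the combination, with weights [t] and
    [1 - t], of the points [t m + (1 - t) v] and [t u + (1 - t) m].  Using the
    inequality at these three places leaves
    [2 t (1 - t) f m <= t (1 - t) (f u + f v)]. *)
Lemma convex_upto_half {R : realType} {f : R -> R} {l r t d : R} :
  0 < t < 1 -> convex_upto f l r t d -> convex_upto f l r 2^-1 d.
Proof.
move=> /andP[t_gt0 t_lt1] f_convex u v u_in v_in uv_le.
set m := _ + _ * v.
have mE : m = (u + v) / 2 by rewrite /m; field.
have m_in : l <= m <= r by rewrite mE; lra.
have [uv_lo uv_hi] : - d <= u - v /\ u - v <= d by apply/andP; rewrite -ler_norml.
have f1 := f_convex m v m_in v_in _.
have f2 := f_convex u m u_in m_in _.
have f3 := f_convex (t * m + (1 - t) * v) (t * u + (1 - t) * m) _ _ _.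
have mid : t * (t * m + (1 - t) * v) + (1 - t) * (t * u + (1 - t) * m) = m.
  by rewrite mE; field.
have dist1 : `|m - v| <= d by rewrite ler_norml mE; lra.
have dist2 : `|u - m| <= d by rewrite ler_norml mE; lra.
have dist3 : `|(t * m + (1 - t) * v) - (t * u + (1 - t) * m)| <= d.
  have -> : t * m + (1 - t) * v - (t * u + (1 - t) * m) = (v - u) / 2.
    by rewrite mE; field.
  by rewrite ler_norml; lra.
have in1 : l <= t * m + (1 - t) * v <= r by apply/andP; split; nra.
have in2 : l <= t * u + (1 - t) * m <= r by apply/andP; split; nra.
move: (f1 dist1) (f2 dist2) (f3 in1 in2 dist3); rewrite mid => {}f1 {}f2 {}f3.
have tt_gt0 : 0 < t * (1 - t) by rewrite mulr_gt0 // subr_gt0.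
have f1t := ler_wpM2l (ltW t_gt0) f1.
have t'_ge0 : 0 <= 1 - t by lra.
have f2t := ler_wpM2l t'_ge0 f2.
have : t * (1 - t) * (2 * f m) <= t * (1 - t) * (f u + f v) by lra.
rewrite ler_pM2l //; lra.
Qed.

(** The midpoint [m] of [u] and [v] is also the midpoint of the two quarter
    points, and each of these is the midpoint of [m] and an endpoint; all three
    pairs are at half the distance of [u] and [v].  Combining the three
    inequalities gives [f m <= (f u + 2 f m + f v) / 4]. *)
Lemma convex_upto_double {R : realType} {f : R -> R} {l r d : R} :
  convex_upto f l r 2^-1 d -> convex_upto f l r 2^-1 (2 * d).
Proof.
move=> f_convex u v u_in v_in; rewrite ler_norml => uv_le.
set m := _ + _ * v.
have mE : m = (u + v) / 2 by rewrite /m; field.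
pose p := 2^-1 * u + (1 - 2^-1) * m; pose q := 2^-1 * m + (1 - 2^-1) * v.
have f1 : f p <= 2^-1 * f u + (1 - 2^-1) * f m.
  by apply: f_convex; rewrite ?ler_norml ?mE; lra.
have f2 : f q <= 2^-1 * f m + (1 - 2^-1) * f v.
  by apply: f_convex; rewrite ?ler_norml ?mE; lra.
have f3 : f (2^-1 * p + (1 - 2^-1) * q) <= 2^-1 * f p + (1 - 2^-1) * f q.
  by apply: f_convex; rewrite ?ler_norml /p /q mE; lra.
have pq_mid : 2^-1 * p + (1 - 2^-1) * q = m by rewrite /p /q mE; field.
rewrite pq_mid in f3; lra.
Qed.

Lemma midpoint_of_convex_upto {R : realType} {f : R -> R} {l r t d : R} :
  0 < t < 1 -> 0 < d -> convex_upto f l r t d ->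
  forall u v, l <= u <= r -> l <= v <= r -> f ((u + v) / 2) <= (f u + f v) / 2.
Proof.
move=> t_in d_gt0 /(convex_upto_half t_in) f_half u v u_in v_in.
have f_pow k : convex_upto f l r 2^-1 (2 ^+ k * d).
  elim: k => [|k IHk]; first by rewrite expr0 mul1r.
  by rewrite exprS -mulrA; apply: convex_upto_double.
pose k := Num.bound (`|u - v| / d).
have dist_le : `|u - v| <= 2 ^+ k * d.
  rewrite -ler_pdivrMr //.
  have lt_k : `|u - v| / d < k%:R.
    by rewrite archi_boundP // divr_ge0 // ltW.
  rewrite (le_trans (ltW lt_k)) // -natrX ler_nat ltnW //.
  exact: ltn_expl.
have := f_pow k u v u_in v_in dist_le.
have -> : 2^-1 * u + (1 - 2^-1) * v = (u + v) / 2 by field.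
lra.
Qed.

(** * Localizing the hypothesis *)

Lemma column_spanP {R : realType} {n : nat} {P : 'M[R]_n} {u : 'cV[R]_n} :
  u \in column_span P -> exists t : 'cV[R]_n, u = P *m t.
Proof.
have : (column_span P <= limg (linfun (mulmx P : 'cV[R]_n -> 'cV[R]_n)))%VS.
  apply/span_subvP => _ /mapP[j _ ->].
  by rewrite colE; apply/memv_imgP; exists (delta_mx j 0);
    rewrite ?memvf // lfunE.
move=> /subvP sub_img /sub_img /memv_imgP[t _ ->].
by exists t; rewrite lfunE.
Qed.

Lemma uniform_cVE {R : realType} {n : nat} (A : {set 'I_n}) (i : 'I_n) :
  uniform_cV R A i 0 = #|A|%:R^-1 * (i \in A)%:R.
Proof.
rewrite !mxE summxE; congr (_ * _).
under eq_bigr => a _ do rewrite mxE eqxx andbT.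
have [iA|niA] := boolP (i \in A).
  rewrite (bigD1 i) //= eqxx big1 ?addr0 // => a /andP[_ /negPf].
  by rewrite eq_sym => ->.
by rewrite big1 // => a aA; case: eqP niA => // ->; rewrite aA.
Qed.

(** The entries of the difference take only three values, so a sum over them
    only depends on the sizes of [A] and [B]. *)
Lemma sum_uniform_cVB {R : realType} {n : nat} {A B : {set 'I_n}}
    (F : R -> R) :
  [disjoint A & B] ->
  \sum_i F ((uniform_cV R A - uniform_cV R B) i 0) =
    n%:R * F 0 + #|A|%:R * (F #|A|%:R^-1 - F 0)
      + #|B|%:R * (F (- #|B|%:R^-1) - F 0).
Proof.
move=> disjAB.
have sum_mem (C : {set 'I_n}) : \sum_i (i \in C)%:R = #|C|%:R :> R.
  by rewrite -sum1_card natr_sum [RHS]big_mkcond; apply: eq_bigr => i _; case: ifP.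
rewrite -!sum_mem !mulr_suml.
have -> : n%:R * F 0 = \sum_(i < n) F 0 by rewrite sumr_const card_ord mulr_natl.
rewrite -!big_split; apply: eq_bigr => i _ /=.
rewrite mxE [X in _ + X]mxE !uniform_cVE !sum_mem.
have [iA|_] := boolP (i \in A).
  rewrite (disjointFr disjAB iA) /= mulr1 mulr0 subr0 mul1r mul0r; ring.
case: (i \in B); rewrite /= ?mulr1 ?mulr0 ?sub0r ?oppr0 ?mul1r ?mul0r; ring.
Qed.

Lemma doubly_stochastic_sum {R : realType} {n : nat} {P : 'M[R]_n}
    (x : 'I_n -> R) :
  doubly_stochastic P -> \sum_i \sum_j P i j * x j = \sum_j x j.
Proof.
case=> _ _ col_sum; rewrite exchange_big; apply: eq_bigr => j _.
by rewrite -mulr_suml col_sum mul1r.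
Qed.

Lemma open_interval_margin {R : realType} {I : set R} {l r : R} :
  open I -> is_interval I -> I l -> I r ->
  exists2 e : R, 0 < e & forall c z, l <= c <= r -> `|z - c| <= e -> I z.
Proof.
move=> I_open I_itv Il Ir.
have margin c : I c -> exists2 e : R, 0 < e & forall z, `|z - c| <= e -> I z.
  move=> Ic; have [e /= e_gt0 ball_sub] := open_nbhs_nbhs (conj I_open Ic).
  exists (e / 2) => [|z z_near]; first by rewrite divr_gt0.
  by apply: ball_sub; rewrite /= distrC (le_lt_trans z_near) //; lra.
have [el el_gt0 Il_near] := margin l Il; have [er er_gt0 Ir_near] := margin r Ir.
exists (Num.min el er) => [|c z c_in]; first by rewrite lt_min el_gt0.
rewrite le_min !ler_norml => z_near.
apply: (I_itv (l - el) (r + er)); last by lra.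
  by apply: Il_near; rewrite ler_norml; lra.
by apply: Ir_near; rewrite ler_norml; lra.
Qed.

(** The inequality comes from the points [x_j = c + s t_j], where [P t] is the
    given vector; the bound on the distance keeps them all in [I], uniformly in
    [c] between [l] and [r]. *)
Lemma convex_upto_of_mean_ineq {R : realType} {I : set R} {f : R -> R}
    {n : nat} {P : 'M[R]_n} {A B : {set 'I_n}} {l r : R} :
  open I -> is_interval I -> I l -> I r -> (0 < n)%N -> doubly_stochastic P ->
  A != finset.set0 -> B != finset.set0 -> [disjoint A & B] ->
  uniform_cV R A - uniform_cV R B \in column_span P ->
  (forall x : 'I_n -> R, (forall i, I (x i)) ->
     f ((\sum_i x i) / n%:R) <= n%:R^-1 * \sum_i f (\sum_j P i j * x j)) ->
  exists2 d : R, 0 < d & convex_upto f l r (#|A|%:R / (#|A|%:R + #|B|%:R)) d.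
Proof.
move=> I_open I_itv Il Ir n_gt0 P_ds A_neq0 B_neq0 disjAB u_span f_ineq.
have [t Pt] := column_spanP u_span.
have [e e_gt0 near_I] := open_interval_margin I_open I_itv Il Ir.
have sum_u (F : R -> R) := sum_uniform_cVB F disjAB.
set u := uniform_cV R A - uniform_cV R B in Pt sum_u.
have a_gt0 : 0 < #|A|%:R :> R by rewrite ltr0n card_gt0.
have b_gt0 : 0 < #|B|%:R :> R by rewrite ltr0n card_gt0.
move: #|A|%:R #|B|%:R a_gt0 b_gt0 sum_u => a b a_gt0 b_gt0 sum_u.
have n_gt0R : 0 < n%:R :> R by rewrite ltr0n.
have ab_gt0 : 0 < a + b by rewrite addr_gt0.
pose T : R := \sum_j `|t j 0|.
have T_ge0 : 0 <= T by apply: sumr_ge0.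
have le_T j : `|t j 0| <= T.
  by rewrite /T (bigD1 j) //= lerDl; apply: sumr_ge0.
pose h := a * b / (a + b).
have h_gt0 : 0 < h by rewrite divr_gt0 // mulr_gt0.
have hT_gt0 : 0 < h * T + 1 by rewrite ltr_wpDl // mulr_ge0 // ltW.
exists (e / (h * T + 1)) => [|p q p_in q_in pq_le]; first by rewrite divr_gt0.
set c : R := _ + _ * q.
(* The value of [s] for which [c + s / a] and [c - s / b] are [p] and [q]. *)
pose s := h * (p - q).
have pE : c + s * a^-1 = p by rewrite /c /s /h; field; rewrite !gt_eqF.
have qE : c + s * - b^-1 = q by rewrite /c /s /h; field; rewrite !gt_eqF.
have w_in : 0 <= a / (a + b) <= 1.
  by rewrite ler_pdivrMr // mul1r lerDl !ltW // divr_gt0.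
have c_in : l <= c <= r by rewrite /c; nra.
pose x j := c + s * t j 0.
have Ix j : I (x j).
  apply: (near_I c) => //; rewrite /x addrAC subrr add0r 2!normrM (gtr0_norm h_gt0).
  move: pq_le; rewrite ler_pdivlMr // => pq_le.
  apply: le_trans (ler_wpM2l _ (le_T j)) _.
    by rewrite mulr_ge0 ?(ltW h_gt0).
  apply: le_trans pq_le; have := normr_ge0 (p - q); lra.
have Px i : \sum_j P i j * x j = c + s * u i 0.
  have [_ row_sum _] := P_ds.
  rewrite Pt mxE mulr_sumr -[c in RHS]mul1r -(row_sum i) mulr_suml -big_split /=.
  by apply: eq_bigr => j _; rewrite /x; ring.
have := f_ineq x Ix.
rewrite -(doubly_stochastic_sum x P_ds).
under eq_bigr => i _ do rewrite Px.
under [X in _ <= _ * X -> _]eq_bigr => i _ do rewrite Px.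
rewrite (sum_u (fun w => c + s * w)) (sum_u (fun w => f (c + s * w))).
rewrite mulr0 addr0 pE qE.
have -> : (n%:R * c + a * (p - c) + b * (q - c)) / n%:R = c.
  by rewrite /c; field; rewrite !gt_eqF.
rewrite [_^-1 * _]mulrC ler_pdivlMr // => f_ineq_c.
have wq : 1 - a / (a + b) = b / (a + b) by field; rewrite gt_eqF.
rewrite wq [_ / _ * f p]mulrAC [_ / _ * f q]mulrAC -mulrDl ler_pdivlMr //.
lra.
Qed.

(** * Jensen convexity and doubly stochastic matrices *)

Theorem theorem2p1 (R : realType) (I : set R) (f : R -> R)
    (I_nonempty : (I !=set0)%classic) (I_open : open I) (I_interval : is_interval I) :
  (forall (n : nat) (P : 'M[R]_n),
      (0 < n)%N ->
      doubly_stochastic P ->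
      (exists A B : {set 'I_n},
          [/\ A != finset.set0, B != finset.set0, [disjoint A & B]
            & uniform_cV R A - uniform_cV R B \in column_span P]) ->
      (forall x : 'I_n -> R, (forall i, I (x i)) ->
          f ((\sum_i x i) / n%:R)
            <= n%:R^-1 * \sum_i f (\sum_j P i j * x j)) ->
      jensen_convex I f)
  /\
  (jensen_convex I f ->
   forall (n : nat) (P : 'M[R]_n),
     (0 < n)%N ->
     doubly_stochastic P ->
     forall x : 'I_n -> R, (forall i, I (x i)) ->
       f ((\sum_i x i) / n%:R)
         <= n%:R^-1 * \sum_i f (\sum_j P i j * x j)).
Proof.
split=> [n P n_gt0 P_ds [A [B [A_neq0 B_neq0 disjAB u_span]]] f_ineq x y Ix Iy
        |f_jensen n P n_gt0 P_ds x Ix].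
  have Imin : I (Num.min x y) by rewrite minEle; case: ifP.
  have Imax : I (Num.max x y) by rewrite maxEle; case: ifP.
  have [d d_gt0 f_upto] := convex_upto_of_mean_ineq I_open I_interval Imin Imax
    n_gt0 P_ds A_neq0 B_neq0 disjAB u_span f_ineq.
  have a_gt0 : 0 < #|A|%:R :> R by rewrite ltr0n card_gt0.
  have b_gt0 : 0 < #|B|%:R :> R by rewrite ltr0n card_gt0.
  have t_in : 0 < (#|A|%:R / (#|A|%:R + #|B|%:R) : R) < 1.
    by rewrite divr_gt0 ?addr_gt0 //= ltr_pdivrMr ?addr_gt0 // mul1r ltrDl.
  by apply: (midpoint_of_convex_upto t_in d_gt0 f_upto);
    rewrite ge_min le_max lexx ?orbT.
rewrite -(doubly_stochastic_sum x P_ds).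
have [P_ge0 row_sum _] := P_ds.
apply: (jensen_mean (I := I)) => // i.
exact: weighted_mean_in_interval.
Qed.
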